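(* Let $0\le q<r\le m$ be integers, let $k\in\mathbb{Z}_{\ge 0}$, and let $A\subseteq\mathbb{Z}_2^m$ be a subcube. For the quantum Reed--Muller code $QRM_m(q,r)$ the following hold: 1. $\widetilde{Z}(k)_A\in\mathcal{S}^{(k)}$ if and only if $\dim A\ge (k+1)r+1$. 2. $\widetilde{Z}(k)_A\in\mathcal{E}^{(k)}$ if and only if $q+kr+1\le\dim A\le (k+1)r$. 3. $Z(k)_A\in\mathcal{S}^{(k)}$ if and only if $\dim A\ge (k+1)r+1$. 4. $Z(k)_A\in\mathcal{E}^{(k)}$ if and only if $q+kr+1\le\dim A\le (k+1)r$.
   Context: Subcubes. $S=\{e_1,\dots,e_m\}$ is the standard basis of $\mathbb{Z}_2^m$ (identified with $[m]$). For $J\subseteq S$, $\langle J\rangle\le\mathbb{Z}_2^m$ is the subgroup generated by $J$. A subcube of type $J$ is a coset $A=x+\langle J\rangle$; $\dim A=|J|$; an $\ell$-cube is a subcube of dimension $\ell$. $|x|$ is Hamming weight. Code. $2^m$ physical qubits are indexed by $\mathbb{Z}_2^m$. For a single-qubit unitary $U$ and $A\subseteq\mathbb{Z}_2^m$, $U_A$ acts as $U$ on each qubit in $A$ and as the identity elsewhere. For $0\le q\le r\le m$, $QRM_m(q,r)\subseteq(\mathbb{C}^2)^{\otimes 2^m}$ is the common $+1$ eigenspace of all $X_A$ with $A$ an $(m-q)$-cube and all $Z_A$ with $A$ an $(r+1)$-cube (none if $r=m$). Operators. $Z(k)=\mathrm{diag}(1,e^{i\pi/2^k})$. $Z(k)_A$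 acts as $Z(k)$ on qubits in $A$, identity elsewhere. $\widetilde{Z}(k)_A$ acts on qubit $x$ as $Z(k)$ if $x\in A$ and $|x|$ is even, as $Z(k)^\dagger$ if $x\in A$ and $|x|$ is odd, and as identity if $x\notin A$. Clifford Hierarchy. With $n=2^m$: $\mathrm{Cl}^{(0)}$ is the $n$-qubit Pauli group (phases $\pm1,\pm i$), and for $k\ge1$, $\mathrm{Cl}^{(k)}=\{U\in \mathrm{U}(2^n): U\,\mathrm{Cl}^{(0)}U^\dagger\subseteq\mathrm{Cl}^{(k-1)}\}$. For a stabilizer code $\mathcal{C}$: $\mathcal{S}^{(k)}=\{U\in\mathrm{Cl}^{(k)}: U|\psi\rangle=|\psi\rangle\ \forall|\psi\rangle\in\mathcal{C}\}$; $\mathcal{N}^{(k)}=\{U\in\mathrm{Cl}^{(k)}: U\mathcal{S}^{(0)}U^\dagger\subseteq\mathcal{S}^{(k-1)}\}$ with the convention $\mathcal{S}^{(-1)}:=\mathcal{S}^{(0)}$; $\mathcal{E}^{(k)}=\mathcal{N}^{(k)}\setminus\mathcal{S}^{(k)}$. Here $\mathcal{C}=QRM_m(q,r)$. *)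

(* Defs.v *)
From HB Require Import structures.
From mathcomp Require Import all_boot all_order all_algebra all_fingroup.
From mathcomp Require Import spectral complex.
From mathcomp Require Import reals trigo.

Set Implicit Arguments.
Unset Strict Implicit.
Unset Printing Implicit Defensive.

Import Order.TTheory GRing.Theory Num.Theory.
Local Open Scope ring_scope.
Local Open Scope sesquilinear_scope.
Local Open Scope complex_scope.

Section Qubits.
Variables (R : realType) (Q : finType).

(** Basis states of the qubits indexed by [Q] are bit assignments; matrices are
    indexed by their ranks in [enum], so [qdim = 2 ^ #|Q|]. *)
Definition qbasis := {ffun Q -> 'I_2}.
Definition qdim := #|{: qbasis}|.
Definition qop := 'M[R[i]]_qdim.
Definition qstate := 'cV[R[i]]_qdim.

(** [\bigotimes_x u x], where [u x] acts on qubit [x]. *)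
Definition tensor (u : Q -> 'M[R[i]]_2) : qop :=
  \matrix_(s, t)
    \prod_(x : Q) u x ((enum_val s : qbasis) x) ((enum_val t : qbasis) x).

Definition on_qubits (U : 'M[R[i]]_2) (A : {set Q}) : qop :=
  tensor (fun x => if x \in A then U else 1%:M).

Definition mx2 (a b c d : R[i]) : 'M[R[i]]_2 :=
  \matrix_(s, t) if s == 0 then (if t == 0 then a else b)
                 else (if t == 0 then c else d).

Definition pauliX := mx2 0 1 1 0.
Definition pauliY := mx2 0 (- 'i) 'i 0.
Definition pauliZ := mx2 1 0 0 (- 1).

Definition expi (t : R) : R[i] := cos t +i* sin t.

Definition Zk (k : nat) := mx2 1 0 0 (expi (pi / 2 ^+ k)).

Definition pauli_group (U : qop) : Prop :=
  exists (c : R[i]) (u : Q -> 'M[R[i]]_2),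
    [/\ c \in [:: 1; - 1; 'i; - 'i],
        forall x, u x \in [:: 1%:M; pauliX; pauliY; pauliZ]
      & U = c *: tensor u].

Fixpoint Cl (k : nat) (U : qop) : Prop :=
  if k is k'.+1 then
    U \is unitarymx /\ forall P, pauli_group P -> Cl k' (U *m P *m U^t*)
  else pauli_group U.

Section Code.
Variable C : qstate -> Prop.

Definition Sk (k : nat) (U : qop) : Prop :=
  Cl k U /\ forall psi, C psi -> U *m psi = psi.

(** Since [0.-1 = 0], the convention [S^(-1) := S^(0)] is built in. *)
Definition Nk (k : nat) (U : qop) : Prop :=
  Cl k U /\ forall V, Sk 0 V -> Sk k.-1 (U *m V *m U^t*).

Definition Ek (k : nat) (U : qop) : Prop := Nk k U /\ ~ Sk k U.
End Code.
End Qubits.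

Notation bitvec m := 'rV['F_2]_m.

Definition std_basis (m : nat) (i : 'I_m) : bitvec m := delta_mx 0 i.

(** Group operations on [bitvec m] are additive: this is [x + <J>]. *)
Definition subcube (m : nat) (x : bitvec m) (J : {set 'I_m}) :
    {set bitvec m} :=
  (x *: <<[set std_basis i | i in J]>>)%g.

Definition is_cube (m l : nat) (A : {set bitvec m}) : Prop :=
  exists (x : bitvec m) (J : {set 'I_m}), #|J| = l /\ A = subcube x J.

Definition hweight (m : nat) (x : bitvec m) : nat :=
  #|[set i : 'I_m | x 0 i != 0]|.

Section ReedMuller.
Variables (R : realType) (m : nat).

Definition QRM (q r : nat) (psi : qstate R (bitvec m)) : Prop :=
  (forall A, is_cube (m - q) A -> on_qubits (pauliX R) A *m psi = psi) /\
  (forall A, is_cube r.+1 A -> on_qubits (pauliZ R) A *m psi = psi).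

Definition Z_on (k : nat) (A : {set bitvec m}) : qop R (bitvec m) :=
  on_qubits (Zk R k) A.

Definition Ztilde_on (k : nat) (A : {set bitvec m}) : qop R (bitvec m) :=
  tensor (fun x => if x \in A then
                     (if odd (hweight x) then (Zk R k)^t* else Zk R k)
                   else 1%:M).
End ReedMuller.

(* Main.v *)
Require Import Defs.
From mathcomp Require Import all_boot all_order all_algebra all_fingroup.
From mathcomp Require Import spectral complex.
From mathcomp Require Import boolp reals trigo.
From mathcomp Require Import ring zify.

(** Idea.  The gate multiplies the basis state [f] by [w ^ E(f)], where
    [w = exp(i pi / 2^k)] has order [2^(k+1)] and [E(f)] is the (signed) sum of
    [f] over [A].  Code states are supported on [RM(r, m)] and invariant under
    translation by [RM(q, m)], so the gate fixes the code iff [2^(k+1)] divides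
    [E(f)] for all [f] in [RM(r, m)], and conjugates stabilizers to stabilizers iff
    [2^(k+1)] divides [E(f + g) - E(f)] for all such [f] and all [g] in [RM(q, m)].
    For [g] the indicator of a cube [B] that difference is the sum of
    [+- (-1)^f] over the cube [A :&: B].  McEliece's theorem says that
    [2^(k+1)] divides all these sums over a cube of dimension at least
    [k r + 1], and a sum of at most [k] disjoint monomials of degree at most [r]
    shows that this is sharp.  The signed and unsigned sums are exchanged by
    adding the parity of the Hamming weight, an element of [RM(1, m)], to [f]. *)

Set Implicit Arguments.
Unset Strict Implicit.
Unset Printing Implicit Defensive.

Import Order.TTheory GRing.Theory Num.Theory FinRing.Theory.
Local Open Scope ring_scope.

(** * Subcubes and Reed-Muller codes *)

(** Every orbit of [h] has exactly one point where [b] holds. This serves both flips of a coordinate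
    and toggling of an element of a set. *)
Lemma big_invol_split (V : nmodType) (T : finType) (h : T -> T)
    (P b : pred T) (F : T -> V) :
  involutive h -> (forall x, P (h x) = P x) -> (forall x, b (h x) = ~~ b x) ->
  \sum_(x | P x) F x = \sum_(x | P x && b x) (F x + F (h x)).
Proof.
move=> hK hP hb; rewrite (bigID b) /= big_split /=; congr (_ + _).
rewrite (reindex_inj (inv_inj hK)) /=.
by apply: eq_bigl => x; rewrite hP hb negbK.
Qed.

Lemma I2_cases (a : 'I_2) : a = 0 \/ a = 1.
Proof. by case: a => [[|[|n]]] // lt_a; [left|right]; apply: val_inj. Qed.

Lemma addI2 (a : 'I_2) : a + a = 0.
Proof. by case: (I2_cases a) => ->; apply: val_inj. Qed.

Lemma signI2D (S : pzRingType) (a b : 'I_2) :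
  (-1) ^+ (a + b)%R = (-1) ^+ a * (-1) ^+ b :> S.
Proof. by rewrite /= modn2 signr_odd exprD. Qed.

Lemma signI2_sum (S : comPzRingType) (I : Type) (s : seq I) (P : pred I)
    (F : I -> 'I_2) :
  (-1) ^+ (\sum_(i <- s | P i) F i)%R = \prod_(i <- s | P i) (-1) ^+ (F i) :> S.
Proof.
elim/big_rec2: _ => [|i a b _ <-]; first by rewrite expr0.
by rewrite signI2D.
Qed.

Section Cubes.
Variable m : nat.
Implicit Types (x y : bitvec m) (J K : {set 'I_m}) (A B C : {set bitvec m}).

Lemma F2_cases (a : 'F_2) : a = 0 \/ a = 1.
Proof. exact: I2_cases. Qed.

Lemma in_subcube x J y :
  (y \in subcube x J) = [forall i, (i \notin J) ==> (y 0 i == x 0 i)].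
Proof.
rewrite /subcube mem_lcoset; set z := (_ * _)%g.
have zE i : z 0 i = y 0 i - x 0 i.
  by rewrite /z zmodMgE zmodVgE !mxE addrC.
have -> : [forall i, (i \notin J) ==> (y 0 i == x 0 i)] =
          [forall i, (i \notin J) ==> (z 0 i == 0)].
  by apply: eq_forallb => i; rewrite zE subr_eq0.
apply/idP/forallP => [zJ i | z0].
  apply/implyP => iJ.
  (* Vectors vanishing at [i] form a group that contains every generator, since [i] is not in
     [J]. *)
  pose G := [set z : bitvec m | z 0 i == 0].
  have gG : group_set G.
    apply/group_setP; split=> [|u v]; first by rewrite inE mxE.
    by rewrite !inE zmodMgE mxE => /eqP -> /eqP ->; rewrite addr0.
  have : <<[set std_basis i | i in J]>>%g \subset Group gG.
    rewrite gen_subG; apply/subsetP => _ /imsetP [j jJ ->].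
    rewrite inE mxE eqxx /=; have [ij|//] := eqVneq i j.
    by rewrite ij jJ in iJ.
  by move/subsetP/(_ z zJ); rewrite inE.
have -> : z = \sum_(i in J) z 0 i *: std_basis i.
  rewrite [LHS]row_sum_delta (bigID (mem J)) /= [X in _ + X]big1 ?addr0 //.
  by move=> i iJ; move: (z0 i); rewrite iJ => /eqP ->; rewrite scale0r.
elim/big_ind: _ => [|u v hu hv|i iJ]; first exact: group1.
  exact: groupM.
case: (F2_cases (z 0 i)) => ->; first by rewrite scale0r; apply: group1.
by rewrite scale1r mem_gen // imset_f.
Qed.

Lemma subcubeP x J y :
  reflect (forall i, i \notin J -> y 0 i = x 0 i) (y \in subcube x J).
Proof.
rewrite in_subcube; apply: (iffP forallP) => h i; last first.
  by apply/implyP => /h ->.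
by move=> iJ; apply/eqP; move: (h i); rewrite iJ.
Qed.

Lemma subcube_refl x J : x \in subcube x J.
Proof. exact/subcubeP. Qed.

Lemma subcubeI x y J K z : z \in subcube x J -> z \in subcube y K ->
  subcube x J :&: subcube y K = subcube z (J :&: K).
Proof.
move=> /subcubeP zx /subcubeP zy; apply/setP => t; rewrite in_setI.
apply/andP/subcubeP => [[/subcubeP tx /subcubeP ty] i | tz].
  rewrite in_setI negb_and => /orP[iJ|iK]; first by rewrite tx // zx.
  by rewrite ty // zy.
split; apply/subcubeP => i h.
  by rewrite tz ?zx // inE negb_and h.
by rewrite tz ?zy // inE negb_and h orbT.
Qed.

Definition flip (i : 'I_m) x : bitvec m := x + std_basis i.

Lemma flipE i x j : flip i x 0 j = x 0 j + (j == i)%:R.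
Proof. by rewrite /flip !mxE eqxx. Qed.

Lemma flipK i : involutive (flip i).
Proof.
move=> x; apply/rowP => j; rewrite !flipE -addrA.
by rewrite (addI2 ((j == i)%:R : 'F_2)) addr0.
Qed.

Lemma flip_neq i x j : j != i -> flip i x 0 j = x 0 j.
Proof. by rewrite flipE => /negbTE ->; rewrite addr0. Qed.

Lemma flip_subcube i x J y : i \in J ->
  (flip i y \in subcube x J) = (y \in subcube x J).
Proof.
move=> iJ; apply/subcubeP/subcubeP => h j jJ; rewrite -(h j jJ).
  by rewrite flip_neq //; apply: contraNneq jJ => ->.
by rewrite flip_neq //; apply: contraNneq jJ => ->.
Qed.

Lemma flip_subcube2 i x J y :
  (flip i y \in subcube (flip i x) J) = (y \in subcube x J).
Proof.
by apply/subcubeP/subcubeP => h j /h; rewrite !flipE; [move/addIr|move=> ->].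
Qed.

Lemma flip_eqC i x (a : 'F_2) : (flip i x 0 i == a) = ~~ (x 0 i == a).
Proof.
rewrite flipE eqxx.
by case: (F2_cases (x 0 i)) => ->; case: (F2_cases a) => ->.
Qed.

Lemma in_subcubeD1 i x J y : i \in J ->
  (y \in subcube x (J :\ i)) = (y \in subcube x J) && (y 0 i == x 0 i).
Proof.
move=> iJ; apply/subcubeP/andP => [h | [/subcubeP h /eqP hi] j].
  split; last by rewrite h // !inE eqxx.
  by apply/subcubeP => j jJ; rewrite h // !inE negb_and jJ orbT.
by rewrite !inE negb_and negbK => /orP[/eqP ->//|]; apply: h.
Qed.

(** Pairing along [i] lets sums cancel edge by edge and splits a cube into two parallel faces. *)
Lemma sum_subcube_flip (V : nmodType) i x J (F : bitvec m -> V) : i \in J ->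
  \sum_(y in subcube x J) F y =
  \sum_(y in subcube x (J :\ i)) (F y + F (flip i y)).
Proof.
move=> iJ.
rewrite (@big_invol_split _ _ (flip i) _ (fun y => y 0 i == x 0 i)) /=.
- by apply: eq_bigl => y; rewrite in_subcubeD1.
- exact: flipK.
- by move=> y; apply: flip_subcube.
- by move=> y; apply: flip_eqC.
Qed.

Definition ind (B : {set bitvec m}) : qbasis (bitvec m) :=
  [ffun x => (x \in B)%:R].

(** [dual_cubes r.+1] is [RM(r, m)], and [span_cubes (m - q)] is [RM(q, m)]. *)
Definition dual_cubes (n : nat) (f : qbasis (bitvec m)) : Prop :=
  forall B, is_cube n B -> \sum_(x in B) f x = 0.

Definition span_cubes (n : nat) (f : qbasis (bitvec m)) : Prop :=
  exists2 s : seq {set bitvec m},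
    (forall B, B \in s -> is_cube n B) & f = \sum_(B <- s) ind B.

Lemma subcube_cube x J : is_cube #|J| (subcube x J).
Proof. by exists x, J. Qed.

Lemma dual_cubesD n f g : dual_cubes n f -> dual_cubes n g -> dual_cubes n (f + g).
Proof.
move=> hf hg B hB; under eq_bigr do rewrite ffunE.
by rewrite big_split /= hf // hg // addr0.
Qed.

Lemma dual_cubes0 n : dual_cubes n 0.
Proof. by move=> B hB; rewrite big1 // => x _; rewrite ffunE. Qed.

(** A cube is the disjoint union of two parallel faces, so vanishing sums pass to higher
    dimensions. *)
Lemma dual_cubes_le n p f : (n <= p)%N -> dual_cubes n f -> dual_cubes p f.
Proof.
move=> /subnK <- hf; elim: (p - n)%N => [//|a IH] B [x [J [cJ ->]]].
have [i iJ] : exists i, i \in J by apply/card_gt0P; rewrite cJ.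
rewrite (sum_subcube_flip _ _ iJ) big_split /=.
have cJi : #|J :\ i| = (a + n)%N by move: cJ; rewrite (cardsD1 i) iJ => -[].
rewrite IH; last by exists x, (J :\ i).
rewrite add0r (reindex_inj (inv_inj (flipK i))) /=.
under eq_bigr do rewrite flipK.
under eq_bigl do rewrite -(flip_subcube2 i) flipK.
by apply: IH; exists (flip i x), (J :\ i).
Qed.


(** Two such cubes are disjoint or meet in a cube of positive dimension, which has evenly many
    points. *)
Lemma dual_cubes_ind n p B : (m < n + p)%N -> is_cube n B ->
  dual_cubes p (ind B).
Proof.
move=> mnp [x [J [cJ ->]]] _ [y [K [cK ->]]].
have -> : \sum_(z in subcube y K) ind (subcube x J) z =
    \sum_(z in subcube y K | z \in subcube x J) 1.
  by rewrite big_mkcondr; apply: eq_bigr => z _; rewrite ffunE; case: ifP.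
have [|[z]] := set_0Vmem (subcube y K :&: subcube x J).
  move=> e0; rewrite big_pred0 // => z.
  by have := in_set0 z; rewrite -e0 in_setI.
rewrite in_setI => /andP[zy zx].
under eq_bigl do rewrite -in_setI (subcubeI zy zx).
have [i iKJ] : exists i, i \in K :&: J.
  apply/card_gt0P; have := cardsUI K J; have := subset_leq_card (subsetT (K :|: J)).
  rewrite cardsT card_ord; lia.
by rewrite (sum_subcube_flip _ _ iKJ) big1 // => t _; rewrite addI2.
Qed.

Lemma ind_subcube_split i x J : i \in J ->
  ind (subcube x J) =
  ind (subcube x (J :\ i)) + ind (subcube (flip i x) (J :\ i)).
Proof.
move=> iJ; apply/ffunP => y; rewrite !ffunE.
rewrite -{3}(flipK i y) flip_subcube2 !in_subcubeD1 // flip_subcube //.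
by rewrite flip_eqC; case: (_ \in _); case: (_ == _); rewrite /= ?addr0 ?add0r.
Qed.

Lemma span_cubes0 n : span_cubes n 0.
Proof. by exists [::]; rewrite ?big_nil. Qed.

Lemma span_cubesD n f g : span_cubes n f -> span_cubes n g ->
  span_cubes n (f + g).
Proof.
move=> [s hs ->] [t ht ->]; exists (s ++ t); last by rewrite big_cat.
by move=> B; rewrite mem_cat => /orP[/hs|/ht].
Qed.

Lemma span_cubes_ind n p B : (n <= p)%N -> is_cube p B -> span_cubes n (ind B).
Proof.
move=> /subnK <-; elim: (p - n)%N B => [|a IH] B.
  by move=> hB; exists [:: B]; rewrite ?big_seq1 // => C; rewrite inE => /eqP ->.
move=> [x [J [cJ ->]]].
have [i iJ] : exists i, i \in J by apply/card_gt0P; rewrite cJ.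
have cJi : #|J :\ i| = (a + n)%N by move: cJ; rewrite (cardsD1 i) iJ => -[].
by rewrite (ind_subcube_split _ iJ); apply: span_cubesD; apply: IH;
  [exists x, (J :\ i)|exists (flip i x), (J :\ i)].
Qed.

Definition supp x : {set 'I_m} := [set i | x 0 i != 0].

Lemma supp_inj : injective supp.
Proof.
move=> x y /setP h; apply/rowP => i; have := h i; rewrite !inE.
by case: (F2_cases (x 0 i)) => ->; case: (F2_cases (y 0 i)) => ->.
Qed.

Lemma in_subcube0 K y : (y \in subcube 0 K) = (supp y \subset K).
Proof.
apply/subcubeP/subsetP => h i.
  by rewrite inE; apply: contraR => /h ->; rewrite mxE.
by move=> iK; rewrite mxE; apply: contraNeq iK => iy; apply: h; rewrite inE.
Qed.

(** If [J] is a proper subset of [K], toggling one element of the difference pairs off the interval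
    between them. *)
Lemma sum_interval_sets (J K : {set 'I_m}) :
  \sum_(L : {set 'I_m} | (J \subset L) && (L \subset K)) (1 : 'I_2) = (J == K)%:R.
Proof.
have [->|JK] := eqVneq J K.
  rewrite (big_pred1 K) // => L /=; by rewrite eqEsubset andbC.
have [sJK|nJK] := boolP (J \subset K); last first.
  rewrite big_pred0 // => L; apply: contraNF nJK => /andP[]; exact: subset_trans.
have /properP[_ [i iK iJ]] : J \proper K by rewrite properEneq JK.
pose h (L : {set 'I_m}) := if i \in L then L :\ i else i |: L.
rewrite (@big_invol_split _ _ h _ (fun L => i \in L)).
- by rewrite big1 // => L _; rewrite addI2.
- move=> L; rewrite /h; case: (boolP (i \in L)) => iL.
    by rewrite setD11 setD1K.
  by rewrite setU11 setU1K.
- move=> L; rewrite /h; case: (boolP (i \in L)) => iL.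
    rewrite subsetD1 iJ andbT; congr andb.
    by rewrite -{2}(setD1K iL) subUset sub1set iK.
  rewrite subUset sub1set iK /=; congr andb.
  apply/idP/idP => [|h1]; last exact: subset_trans h1 (subsetUr _ _).
  by move/(setSD [set i]); rewrite setU1K // => /(subset_trans _) -> //;
    rewrite subsetD1 subxx.
- by move=> L; rewrite /h; case: ifP => iL; rewrite ?setD11 ?setU11.
Qed.

(* Moebius inversion over the Boolean lattice, in characteristic two. *)
Lemma moebius_cubes (f : qbasis (bitvec m)) x :
  f x = \sum_(K : {set 'I_m} | K \subset supp x) \sum_(y in subcube 0 K) f y.
Proof.
under eq_bigr do under eq_bigl do rewrite in_subcube0.
(* Now [f y] appears once for each set between [supp y] and [supp x], an even number of times unless
   [y = x]. *)
rewrite (exchange_big_dep predT) //= (bigD1 x) //= [X in _ + X]big1 ?addr0.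
  under eq_bigl do rewrite andbC.
  by rewrite -(mulr1 (f x)) -big_distrr /= sum_interval_sets eqxx mulr1.
move=> y yx; under eq_bigl do rewrite andbC.
under eq_bigr do rewrite -(mulr1 (f y)).
rewrite -big_distrr /= sum_interval_sets.
by rewrite (inj_eq supp_inj) (negbTE yx) mulr0.
Qed.

(** Moebius inversion yields the algebraic normal form: the sum over [subcube 0 K] is the
    coefficient of the monomial on [K]. It vanishes when [#|K|] exceeds [r], and each remaining
    monomial is the indicator of a cube of codimension [#|K|]. *)
Lemma dual_cubes_span r f : (r <= m)%N ->
  dual_cubes r.+1 f -> span_cubes (m - r) f.
Proof.
move=> rm hf.
(* The cube through the 0-1 vector of [K] with free directions off [K] is where the monomial on [K]
   equals 1. *)
pose one K : bitvec m := \row_i (i \in K)%:R.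
have inK K x : (x \in subcube (one K) (~: K)) = (K \subset supp x).
  apply/subcubeP/subsetP => h i iK.
    by rewrite inE h ?inE ?iK // mxE iK.
  move: iK; rewrite inE negbK mxE => iK; have := h i iK; rewrite inE iK.
  by case: (F2_cases (x 0 i)) => ->.
have -> : f = \sum_(K : {set 'I_m} |
      (#|K| <= r)%N && (\sum_(y in subcube 0 K) f y != 0))
    ind (subcube (one K) (~: K)).
  apply/ffunP => x; rewrite moebius_cubes sum_ffunE.
  rewrite big_mkcond [RHS]big_mkcond /=; apply: eq_bigr => K _.
  rewrite ffunE inK; have [cK|cK] /= := leqP #|K| r; last first.
    rewrite (dual_cubes_le cK hf) ?if_same //; exact: subcube_cube.
  by case: (I2_cases (\sum_(y in subcube 0 K) f y)) => ->; case: (K \subset _).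
elim/big_ind: _ => [|g h|K /andP[cK _]]; first exact: span_cubes0.
  exact: span_cubesD.
apply: span_cubes_ind (subcube_cube _ _).
have := cardsC K; rewrite card_ord; lia.
Qed.

End Cubes.

(** * Divisibility of sign sums over cubes *)

Section Sums.
Variable m : nat.
Implicit Types (x y : bitvec m) (J K : {set 'I_m}) (A B C : {set bitvec m}).
Implicit Types (f g : qbasis (bitvec m)) (chi : bitvec m -> int).

Lemma sign_add_ind f B x :
  (-1) ^+ ((f + ind B)%R x) =
  (-1) ^+ (f x) - (if x \in B then 2 * (-1) ^+ (f x) else 0) :> int.
Proof.
rewrite !ffunE signI2D; case: ifP => _; last by rewrite mulr1 subr0.
by case: (I2_cases (f x)) => ->.
Qed.

Lemma val_add_ind f B x :
  ((f + ind B)%R x)%:Z - (f x)%:Z = if x \in B then (-1) ^+ (f x) else 0.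
Proof.
rewrite !ffunE; case: ifP => _; last by rewrite addr0 subrr.
by case: (I2_cases (f x)) => ->.
Qed.

Definition wsign x : int := (-1) ^+ hweight x.

Lemma wsign_flip i x : wsign (flip i x) = - wsign x.
Proof.
have wE y : wsign y = \prod_j (-1) ^+ (y 0 j != 0).
  rewrite /wsign /hweight -sum1_card big_mkcond /= expr_sum.
  by apply: eq_bigr => j _; rewrite inE; case: (_ == _).
rewrite !wE (bigD1 i) //= [in RHS](bigD1 i) //= -mulNr; congr (_ * _).
  by rewrite flip_eqC; case: (_ == _).
by apply: eq_bigr => j ji; rewrite flip_neq.
Qed.

Definition wparity : qbasis (bitvec m) := [ffun x => (odd (hweight x))%:R].

Lemma sign_wparity x : (-1) ^+ (wparity x) = wsign x.
Proof. by rewrite ffunE /wsign -[RHS]signr_odd; case: (odd _). Qed.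

(** The parity sums to 1 along each edge, hence to 0 on each square. *)
Lemma dual_cubes_wparity n : (2 <= n)%N -> dual_cubes n wparity.
Proof.
move=> n2 B [x [J [cJ ->]]].
have [i iJ] : exists i, i \in J by apply/card_gt0P; rewrite cJ; lia.
have [j jJ] : exists j, j \in J :\ i.
  by apply/card_gt0P; move: cJ; rewrite (cardsD1 i) iJ; lia.
rewrite (sum_subcube_flip _ _ iJ) (sum_subcube_flip _ _ jJ) big1 // => y _.
have one z : wparity z + wparity (flip i z) = 1.
  have := wsign_flip i z; rewrite -!sign_wparity.
  case: (I2_cases (wparity z)) => ->; case: (I2_cases (wparity (flip i z))) => ->;
    by rewrite ?addr0 ?add0r // => /eqP.
by rewrite !one addI2.
Qed.

(** Signs are reversed exactly on [B]. The factor 2 is the source of the powers of two below. *)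
Lemma sum_sign_add_ind chi f A B :
  \sum_(x in A) chi x * (-1) ^+ ((f + ind B)%R x) =
  \sum_(x in A) chi x * (-1) ^+ (f x) -
    2 * \sum_(x in A :&: B) chi x * (-1) ^+ (f x).
Proof.
rewrite big_distrr /= (big_setID B) /= [X in _ = X - _](big_setID B) /=.
have e : \sum_(x in A :\: B) chi x * (-1) ^+ ((f + ind B)%R x) =
         \sum_(x in A :\: B) chi x * (-1) ^+ (f x).
  apply: eq_bigr => x; rewrite inE => /andP[/negbTE xB _].
  by rewrite sign_add_ind xB subr0.
rewrite e addrAC -sumrB; congr (_ + _); apply: eq_bigr => x.
by rewrite inE => /andP[_ xB]; rewrite sign_add_ind xB mulrBr mulrCA.
Qed.

(* McEliece's divisibility theorem.  Adding one generator of codimension at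
   most [r] costs twice a sum over a cube of dimension at least [#|J| - r]. *)
Lemma wsum_dvd r f : (r <= m)%N -> span_cubes (m - r) f ->
  forall k x J, (k * r + 1 <= #|J|)%N ->
  (2 ^+ k.+1 %| \sum_(y in subcube x J) wsign y * (-1) ^+ (f y))%Z.
Proof.
move=> rm [s hs ->]; elim: s hs => [|B s IH] hs k x J hJ.
  (* For the zero word the weight signs cancel along any direction of [J]. *)
  have [i iJ] : exists i, i \in J by apply/card_gt0P; lia.
  rewrite (sum_subcube_flip _ _ iJ) big1 ?dvdz0 // => y _.
  by rewrite wsign_flip !big_nil !ffunE mulNr subrr.
have {}IH := IH (fun C h => hs C (mem_behead (s := B :: s) h)).
rewrite big_cons addrC sum_sign_add_ind rpredB ?IH //.
(* For [k = 0] the explicit factor 2 is all that the new term has to supply. *)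
case: k hJ => [|k] hJ; first by rewrite dvdz_mulr.
rewrite exprS dvdz_mul //.
have [y [K [cK ->]]] := hs B (mem_head _ _).
have [->|[z]] := set_0Vmem (subcube x J :&: subcube y K).
  by rewrite big_set0 dvdz0.
rewrite in_setI => /andP[zx zy]; rewrite (subcubeI zx zy); apply: IH.
have := cardsUI J K; have := subset_leq_card (subsetT (J :|: K)).
rewrite cardsT card_ord; lia.
Qed.

Lemma exists_subset_card (T : finType) (D : {set T}) n : (n <= #|D|)%N ->
  exists2 L : {set T}, L \subset D & #|L| = n.
Proof.
move=> nD; exists [set x in take n (enum D)].
  by apply/subsetP => x; rewrite inE => /mem_take; rewrite mem_enum.
rewrite cardsE (card_uniqP _) ?take_uniq ?enum_uniq // size_take -cardE.
by case: ltngtP nD.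
Qed.

(* The witness is a sum of at most [k] monomials of degree at most [r] on
   disjoint sets of coordinates that cover [J]. *)
Lemma wsum_sharp r k x J : (#|J| <= k * r)%N ->
  exists f, [/\ dual_cubes r.+1 f, forall i y, i \notin J -> f (flip i y) = f y
    & exists2 n, (n <= k)%N &
      `|\sum_(y in subcube x J) wsign y * (-1) ^+ (f y)| = 2 ^+ n].
Proof.
elim: k J => [|k IH] J hJ.
  have J0 : J = set0 by apply/eqP; rewrite -cards_eq0; lia.
  exists 0; split; [exact: dual_cubes0| |exists 0%N => //].
    by move=> i y _; rewrite !ffunE.
  rewrite (big_pred1 x) ?ffunE ?mulr1 ?normrX ?normrN1 ?expr1n // => y.
  apply/subcubeP/eqP => [h|-> //]; apply/rowP => i; apply: h; by rewrite J0 inE.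
have [kJ|kJ] := leqP #|J| (k * r).
  by have [f [f1 f2 [n nk fn]]] := IH J kJ; exists f; split => //; exists n; lia.
have [J1 sJ1 cJ1] := exists_subset_card (ltnW kJ).
have [f [f1 f2 [n nk fn]]] := IH J1 (eq_leq cJ1).
(* At most [r] directions are left over; the indicator of the cube through [x] that fixes them is a
   product of [#|J2|] affine factors. *)
pose J2 := J :\: J1.
have cJ2 : (#|J2| = #|J| - k * r)%N by rewrite cardsD (setIidPr sJ1) cJ1.
exists (f + ind (subcube x (~: J2))); split.
- apply: dual_cubesD => //; apply: dual_cubes_ind (subcube_cube _ _).
  have := cardsC J2; rewrite card_ord; lia.
- move=> i y iJ; rewrite ![in LHS]ffunE ![in RHS]ffunE f2.
    by rewrite flip_subcube // !inE negb_and iJ orbT.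
  by apply: contra iJ; apply: (subsetP sJ1).
exists n.+1 => //.
(* Since [f] ignores the directions in [J2], the old sum cancels along one of them. Up to sign,
   twice the sum over the cube of type [J1] remains. *)
have [i iJ2] : exists i, i \in J2 by apply/card_gt0P; lia.
move: (iJ2); rewrite inE => /andP[iJ1 iJ].
rewrite sum_sign_add_ind (sum_subcube_flip _ _ iJ) big1.
  rewrite (subcubeI (subcube_refl _ _) (subcube_refl _ _)).
  have -> : J :&: ~: J2 = J1.
    apply/setP => j; rewrite !inE negb_and negbK.
    case: (boolP (j \in J1)) => [jJ1|_]; first by rewrite (subsetP sJ1).
    by case: (j \in J).
  by rewrite sub0r normrN normrM fn exprS.
by move=> y _; rewrite wsign_flip f2 // mulNr subrr.
Qed.

(** Cutting by a cube of codimension [e] costs at most [e] dimensions, so McEliece's bound applies.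
    Conversely, if [#|J| <= e + k * r], some cut leaves at most [k * r] directions, and the sharp
    witness has a sum not divisible by [2 ^ k.+1]. *)
Lemma wsum_dvdP r k e x J : (r <= m)%N -> (e <= m)%N ->
  (forall f B, dual_cubes r.+1 f -> is_cube (m - e) B ->
    (2 ^+ k.+1 %| \sum_(y in subcube x J :&: B) wsign y * (-1) ^+ (f y))%Z)
  <-> (e + k * r + 1 <= #|J|)%N.
Proof.
move=> rm em; split=> [h|hJ f B hf [y [K [cK ->]]]].
  rewrite addn1 ltnNge; apply/negP => hJ.
  (* [L] collects the directions fixed by the cut: [e] of them inside [J] if possible, otherwise all
     of [J] and some outside. *)
  have [L cL hL] : exists2 L : {set 'I_m}, #|L| = e & (#|J :\: L| <= k * r)%N.
    have [eJ|eJ] := leqP e #|J|.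
      have [L sL cL] := exists_subset_card eJ; exists L => //.
      by rewrite cardsD (setIidPr sL) cL; lia.
    have cCJ : (e - #|J| <= #|~: J|)%N by have := cardsC J; rewrite card_ord; lia.
    have [L sL cL] := exists_subset_card cCJ; exists (J :|: L).
      have JL0 : J :&: L = set0.
        by apply/disjoint_setI0; rewrite disjoint_sym disjoints_subset.
      by rewrite cardsU cL JL0 cards0; lia.
    by rewrite setDUr setDv set0I cards0.
  have [f [f1 _ [n nk fn]]] := wsum_sharp x hL.
  have cL' : #|~: L| = (m - e)%N by have := cardsC L; rewrite card_ord; lia.
  have := h f (subcube x (~: L)) f1; rewrite -cL'.
  rewrite (subcubeI (subcube_refl _ _) (subcube_refl _ _)) -setDE.
  move=> /(_ (subcube_cube _ _)); rewrite dvdzE.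
  have -> : `|(\sum_(y in subcube x (J :\: L)) wsign y * (-1) ^+ (f y))%R|%N =
      (2 ^ n)%N.
    by apply/eqP; rewrite -eqz_nat abszE fn -(natz (2 ^ n)) natrX.
  by rewrite abszX dvdn_Pexp2l // ltnNge (leq_trans nk) .
have [->|[z]] := set_0Vmem (subcube x J :&: subcube y K).
  by rewrite big_set0 dvdz0.
rewrite in_setI => /andP[zx zy]; rewrite (subcubeI zx zy).
apply: (wsum_dvd rm (dual_cubes_span rm hf)).
have := cardsUI J K; have := subset_leq_card (subsetT (J :|: K)).
rewrite cardsT card_ord; lia.
Qed.


(** * Phases of the alternating and the plain gates *)

Definition qubit_sign (alt : bool) x : int := if alt then wsign x else 1.

(** Adding [wparity] to [f] exchanges signed and unsigned sums; it preserves the code because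
    [0 < r] puts [wparity] in RM(r, m). *)
Lemma qubit_sign_dvdP alt r k e x J : (0 < r)%N -> (r <= m)%N -> (e <= m)%N ->
  (forall f B, dual_cubes r.+1 f -> is_cube (m - e) B ->
    (2 ^+ k.+1 %|
      \sum_(y in subcube x J :&: B) qubit_sign alt y * (-1) ^+ (f y))%Z)
  <-> (e + k * r + 1 <= #|J|)%N.
Proof.
move=> r0 rm em; rewrite -(wsum_dvdP k x J rm em).
case: alt; first by [].
have shift f A : \sum_(y in A) qubit_sign false y * (-1) ^+ ((f + wparity)%R y) =
    \sum_(y in A) wsign y * (-1) ^+ (f y).
  apply: eq_bigr => y _; rewrite mul1r [X in (-1) ^+ nat_of_ord X]ffunE.
  by rewrite signI2D sign_wparity mulrC.
have wD : dual_cubes r.+1 wparity by apply: dual_cubes_wparity.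
split=> h f B hf hB; first by rewrite -shift; apply: h => //; apply: dual_cubesD.
have -> : f = (f + wparity) + wparity.
  by apply/ffunP => y; rewrite !ffunE -addrA addI2 addr0.
by rewrite shift; apply: h => //; apply: dual_cubesD.
Qed.

(** [diag(1, w ^ chi x)] on every qubit [x] of [A] multiplies the basis state
    [f] by [w ^ phase chi A f]. *)
Definition phase chi A f : int := \sum_(x in A) chi x * (f x)%:Z.

(** Complementing a bit [b] changes it by [1 - 2 b], which is [(-1) ^ b]. *)
Lemma phase_add_ind chi A B f :
  phase chi A (f + ind B) - phase chi A f =
  \sum_(x in A :&: B) chi x * (-1) ^+ (f x).
Proof.
rewrite -sumrB [RHS]big_mkcond [LHS]big_mkcond; apply: eq_bigr => x _.
rewrite inE -mulrBr val_add_ind; case: (x \in A) => //=.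
by case: ifP => // _; rewrite mulr0.
Qed.

Lemma phase_step_dvdP alt r k e x J : (0 < r)%N -> (r <= m)%N -> (e <= m)%N ->
  (forall f B, dual_cubes r.+1 f -> is_cube (m - e) B ->
    (2 ^+ k.+1 %| phase (qubit_sign alt) (subcube x J) (f + ind B) -
                  phase (qubit_sign alt) (subcube x J) f)%Z)
  <-> (e + k * r + 1 <= #|J|)%N.
Proof.
move=> r0 rm em; rewrite -(qubit_sign_dvdP alt k x J r0 rm em).
by split=> h f B hf hB; have := h f B hf hB; rewrite phase_add_ind.
Qed.

Lemma phase0 chi A : phase chi A 0 = 0.
Proof. by rewrite /phase big1 // => x _; rewrite ffunE mulr0. Qed.

Lemma dual_cubes_span_ind n r f (s : seq {set bitvec m}) :
  (m < n + r)%N -> (forall B, B \in s -> is_cube n B) -> dual_cubes r f ->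
  dual_cubes r (f + \sum_(B <- s) ind B).
Proof.
move=> nr; elim: s f => [|B s IH] f hs hf; first by rewrite big_nil addr0.
rewrite big_cons addrA; apply: IH => [C hC|].
  by apply: hs; rewrite inE hC orbT.
apply: dual_cubesD hf (dual_cubes_ind nr _); exact/hs/mem_head.
Qed.

(** The difference telescopes over the cubes that make up [g]; intermediate words stay in the code
    because [m < n + r]. *)
Lemma phase_span_dvd n r k chi A f g :
  (m < n + r)%N -> dual_cubes r f -> span_cubes n g ->
  (forall f B, dual_cubes r f -> is_cube n B ->
    (2 ^+ k.+1 %| phase chi A (f + ind B) - phase chi A f)%Z) ->
  (2 ^+ k.+1 %| phase chi A (f + g) - phase chi A f)%Z.
Proof.
move=> nr hf [s hs ->] h; elim: s f hf hs => [|B s IH] f hf hs.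
  by rewrite big_nil addr0 subrr dvdz0.
have hB : is_cube n B by apply/hs/mem_head.
rewrite big_cons addrA -(subrKA (phase chi A (f + ind B))) rpredD //; last exact: h.
apply: IH => [|C hC]; last by apply: hs; rewrite inE hC orbT.
exact: dual_cubesD hf (dual_cubes_ind nr hB).
Qed.

(** Cubes of codimension [r] span RM(r, m), so each word is reached from 0, where the phase
    vanishes, by adding such cubes. This is the step criterion at [e = r]. *)
Lemma phase_dvdP alt r k x J : (0 < r)%N -> (r <= m)%N ->
  (forall f, dual_cubes r.+1 f ->
    (2 ^+ k.+1 %| phase (qubit_sign alt) (subcube x J) f)%Z)
  <-> ((k + 1) * r + 1 <= #|J|)%N.
Proof.
move=> r0 rm; rewrite mulnDl mul1n (addnC (k * r)%N).
rewrite -(phase_step_dvdP alt k x J r0 rm rm); split=> [h f B hf hB|h f hf].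
  rewrite rpredB ?h //; apply: dual_cubesD hf (dual_cubes_ind _ hB); lia.
rewrite -[phase _ _ _]subr0 -(phase0 (qubit_sign alt) (subcube x J)) -[f]add0r.
apply: (phase_span_dvd (n := m - r) (r := r.+1)) (@dual_cubes0 _ _) _ h.
  by lia.
exact: dual_cubes_span.
Qed.

End Sums.

(** * Tensor products of one-qubit operators *)

Local Open Scope sesquilinear_scope.
Local Open Scope complex_scope.

Section Tensor.
Variables (R : realType) (Q : finType).
Local Notation C := R[i].
Implicit Types (u v : Q -> 'M[C]_2) (f g : qbasis Q) (psi : qstate R Q).

Lemma sum_qdim (V : nmodType) (F : 'I_(qdim Q) -> V) :
  \sum_s F s = \sum_(f : qbasis Q) F (enum_rank f).
Proof. exact: reindex (onW_bij _ (@enum_rank_bij _)). Qed.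

Lemma tensorM u v : tensor u *m tensor v = tensor (fun x => u x *m v x).
Proof.
apply/matrixP => s t; rewrite !mxE sum_qdim.
under [RHS]eq_bigr do rewrite mxE.
rewrite bigA_distr_bigA /=; apply: eq_bigr => f _.
by rewrite !mxE enum_rankK -big_split.
Qed.

Lemma tensor_adj u : (tensor u)^t* = tensor (fun x => (u x)^t*).
Proof.
apply/matrixP => s t; rewrite !mxE rmorph_prod.
by apply: eq_bigr => x _; rewrite !mxE.
Qed.

Lemma tensorZ (c : Q -> C) u :
  tensor (fun x => c x *: u x) = (\prod_x c x) *: tensor u.
Proof.
apply/matrixP => s t; rewrite !mxE -big_split.
by apply: eq_bigr => x _; rewrite mxE.
Qed.

Lemma tensor1 : tensor (fun _ : Q => 1%:M : 'M[C]_2) = 1%:M.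
Proof.
apply/matrixP => s t; rewrite !mxE; have [->|st] := eqVneq s t.
  by rewrite big1 // => x _; rewrite mxE eqxx.
have [x xst] : exists x, enum_val s x != enum_val t x.
  apply/existsP; apply: contra_neqT st; rewrite negb_exists => /forallP h.
  by apply: enum_val_inj; apply/ffunP => x; apply/eqP; rewrite -[_ == _]negbK.
by rewrite (bigD1 x) //= mxE (negbTE xst) mul0r.
Qed.

Lemma eq_tensor u v : (forall x, u x = v x) -> tensor u = tensor v.
Proof.
by move=> uv; apply/matrixP => s t; rewrite !mxE; apply: eq_bigr => x _; rewrite uv.
Qed.

Lemma tensor_unitary u : (forall x, u x \is unitarymx) -> tensor u \is unitarymx.
Proof.
move=> hu; apply/unitarymxP; rewrite tensor_adj tensorM -tensor1.
by apply: eq_tensor => x; apply/unitarymxP.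
Qed.

Definition amp psi f : C := psi (enum_rank f) 0.

Lemma qstate_ext psi phi : (forall f, amp psi f = amp phi f) -> psi = phi.
Proof.
move=> h; apply/colP => s; rewrite -(enum_valK s); exact: h.
Qed.

(** Row [i] of [u x] is supported in column [i + g x], so one basis state contributes. Diagonal
    gates ([g = 0]) and Pauli operators both have this form. *)
Lemma amp_tensor u g (v : Q -> 'I_2 -> C) psi f :
  (forall x i j, u x i j = if j == i + g x then v x i else 0) ->
  amp (tensor u *m psi) f = (\prod_x v x (f x)) * amp psi (f + g).
Proof.
move=> hu; rewrite /amp mxE sum_qdim (bigD1 (f + g)) //= [X in _ + X]big1.
  rewrite addr0 mxE !enum_rankK; congr (_ * _).
  by apply: eq_bigr => x _; rewrite hu ffunE eqxx.
move=> h hfg; have [x hx] : exists x, h x != f x + g x.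
  apply/existsP; apply: contra_neqT hfg; rewrite negb_exists => /forallP e.
  by apply/ffunP => x; apply/eqP; rewrite ffunE -[_ == _]negbK.
by rewrite mxE (bigD1 x) //= !enum_rankK hu (negbTE hx) mul0r mul0r.
Qed.

End Tensor.

(** * Pauli matrices and phase gates on one qubit *)

Section Qubit.
Variable R : realType.
Local Notation C := R[i].
Implicit Types (a b c d w : C) (p : 'M[C]_2).

Lemma mx2M a b c d a' b' c' d' :
  mx2 a b c d *m mx2 a' b' c' d' =
  mx2 (a * a' + b * c') (a * b' + b * d') (c * a' + d * c') (c * b' + d * d').
Proof.
apply/matrixP => i j; rewrite !mxE !big_ord_recl big_ord0 !mxE /= addr0.
by case: (I2_cases i) => ->; case: (I2_cases j) => ->.
Qed.

Lemma mx2_adj a b c d : (mx2 a b c d)^t* = mx2 a^*%R c^*%R b^*%R d^*%R.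
Proof.
apply/matrixP => i j; rewrite !mxE.
by case: (I2_cases i) => ->; case: (I2_cases j) => ->.
Qed.

Lemma mx2Z e a b c d : e *: mx2 a b c d = mx2 (e * a) (e * b) (e * c) (e * d).
Proof.
apply/matrixP => i j; rewrite !mxE.
by case: (I2_cases i) => ->; case: (I2_cases j) => ->.
Qed.

Lemma mx2_1 : 1%:M = mx2 1 0 0 1 :> 'M[C]_2.
Proof.
apply/matrixP => i j; rewrite !mxE.
by case: (I2_cases i) => ->; case: (I2_cases j) => ->.
Qed.

Lemma unity_norm n w : (0 < n)%N -> w ^+ n = 1 -> `|w| = 1.
Proof.
move=> n0 wn; apply/eqP; rewrite -(@pexpr_eq1 _ _ n) ?normr_ge0 -?lt0n //.
by rewrite -normrX wn normr1.
Qed.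

Lemma unity_conj n w : (0 < n)%N -> w ^+ n = 1 -> w * w^*%R = 1.
Proof. by move=> n0 wn; rewrite -normCK (unity_norm n0 wn) expr1n. Qed.

Lemma sqri : 'i * 'i = -1 :> C.
Proof. by rewrite -expr2 sqrCi. Qed.

Lemma conji : ('i : C)^*%R = - 'i.
Proof.
have h : 'i * ('i : C)^*%R = 1.
  by apply: (@unity_conj 4) => //; rewrite (exprM _ 2 2) sqrCi sqrrN expr1n.
by rewrite -[LHS]mul1r -[X in X * _]opprK -sqri mulNr -mulrA h mulr1.
Qed.

Lemma conjNi : (- 'i : C)^*%R = 'i.
Proof. by rewrite -conji conjCK. Qed.

Definition paulis : seq 'M[C]_2 := [:: 1%:M; pauliX R; pauliY R; pauliZ R].

Lemma paulisP p : p \in paulis ->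
  [\/ p = 1%:M, p = pauliX R, p = pauliY R | p = pauliZ R].
Proof.
by rewrite !inE => /or4P[]/eqP ->;
  [constructor 1|constructor 2|constructor 3|constructor 4].
Qed.

(** The root of unity [c] is the global phase produced by conjugation. *)
Definition qubit_level (k : nat) (M : 'M[C]_2) : Prop :=
  exists c w p, [/\ c ^+ (2 ^ k.+2) = 1, w ^+ (2 ^ k.+1) = 1, p \in paulis
    & M = c *: (mx2 1 0 0 w *m p)].

(** Here [w] is 1 or -1, so the diagonal factor is the identity or Z, and Z times a Pauli matrix is
    one up to a power of ['i]. *)
Lemma qubit_level0 M : qubit_level 0 M ->
  exists c p, [/\ c ^+ 4 = 1, p \in paulis & M = c *: p].
Proof.
move=> [c [w [p [c4 /eqP w2 hp ->]]]].
have i4 : ('i : C) ^+ 4 = 1 by rewrite (exprM _ 2 2) sqrCi sqrrN expr1n.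
move: w2; rewrite sqrf_eq1 => /orP[]/eqP ->.
  by exists c, p; rewrite -mx2_1 mul1mx.
case/paulisP: hp => ->.
- by exists c, (pauliZ R); rewrite mulmx1 !inE eqxx !orbT.
- exists (c * 'i), (pauliY R); rewrite exprMn c4 i4 mul1r !inE eqxx !orbT.
  split=> //; rewrite mx2M !mx2Z ?complexiE; congr mx2; first [ring | ring: sqri].
- exists (- (c * 'i)), (pauliX R); rewrite exprNn exprMn c4 i4 !inE eqxx !orbT.
  split=> //; first by ring.
  by rewrite mx2M !mx2Z ?complexiE; congr mx2; first [ring | ring: sqri].
- exists c, 1%:M; rewrite !inE eqxx; split=> //.
  by rewrite mx2_1 mx2M !mx2Z; congr mx2; ring.
Qed.

Lemma pauli_adj p : p \in paulis -> p^t* = p.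
Proof.
by case/paulisP => ->; rewrite ?mx2_1 /pauliY mx2_adj ?complexiE
  ?conjNi ?conji ?rmorphN ?rmorph0 ?rmorph1.
Qed.

Lemma pauli_unitary p : p \in paulis -> p \is unitarymx.
Proof.
move=> hp; apply/unitarymxP; rewrite (pauli_adj hp); case/paulisP: hp => ->;
  rewrite ?mx2_1 mx2M ?complexiE; congr mx2; first [ring | ring: sqri].
Qed.

(** Pauli matrices are self-adjoint involutions that pairwise commute or anticommute. *)
Lemma pauli_conj p q : p \in paulis -> q \in paulis ->
  exists2 s, s = 1 \/ s = -1 & q *m p *m q^t* = s *: p.
Proof.
move=> /paulisP hp /paulisP hq.
rewrite pauli_adj; last by case: hq => ->; rewrite !inE eqxx ?orbT.
have h : q *m p *m q = p \/ q *m p *m q = -1 *: p.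
  case: hp => ->; case: hq => ->;
  rewrite ?mx2_1 /pauliX /pauliY /pauliZ !mx2M !mx2Z ?complexiE;
  first [by left; congr mx2; first [ring | ring: sqri]
        |by right; congr mx2; first [ring | ring: sqri]].
by case: h => ->; [exists 1; rewrite ?scale1r; auto|exists (-1); auto].
Qed.

End Qubit.

(** * The Clifford hierarchy *)

Section Clifford.
Variable R : realType.
Local Notation C := R[i].
Implicit Types (c w : C).

Lemma adjmxM l n p (A : 'M[C]_(l, n)) (B : 'M[C]_(n, p)) :
  (A *m B)^t* = B^t* *m A^t*.
Proof. by rewrite trmx_mul map_mxM. Qed.

Lemma adjmxZ n p c (A : 'M[C]_(n, p)) : (c *: A)^t* = c^*%R *: A^t*.
Proof. by apply/matrixP => i j; rewrite !mxE rmorphM. Qed.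

Lemma conj_scale_mx n c (A V : 'M[C]_n) :
  (c *: A) *m V *m (c *: A)^t* = (c * c^*%R) *: (A *m V *m A^t*).
Proof. by rewrite adjmxZ -!scalemxAl -scalemxAr scalerA. Qed.

Lemma scale_unitarymx n c (A : 'M[C]_n) : c * c^*%R = 1 ->
  A \is unitarymx -> c *: A \is unitarymx.
Proof.
move=> cc /unitarymxP AA; apply/unitarymxP.
by rewrite -[X in X *m _]mulmx1 conj_scale_mx mulmx1 AA cc scale1r.
Qed.

(** The identity and Z commute with the gate; for X and Y, [diag(1, w) X diag(1, w^-1) = w^-1
    diag(1, w^2) X]. Squaring [w] is what lowers the level. *)
Lemma diag_conj_pauli w (p : 'M[C]_2) : w * w^*%R = 1 -> p \in paulis R ->
  exists s w', [/\ s = 1 \/ s = w^*%R, w' = 1 \/ w' = w ^+ 2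
    & mx2 1 0 0 w *m p *m (mx2 1 0 0 w)^t* = s *: (mx2 1 0 0 w' *m p)].
Proof.
move=> ww /paulisP[] ->; rewrite ?mx2_1 /pauliX /pauliY /pauliZ mx2_adj
  ?rmorph0 ?rmorph1 ?complexiE; [exists 1, 1|exists w^*%R, (w ^+ 2)|
  exists w^*%R, (w ^+ 2)|exists 1, 1]; split; auto;
  by rewrite !mx2M mx2Z; congr mx2; first [ring|ring: ww].
Qed.

Lemma diag_unitary w : w * w^*%R = 1 -> mx2 1 0 0 w \is unitarymx.
Proof.
move=> ww; apply/unitarymxP; rewrite mx2_adj ?rmorph0 ?rmorph1 mx2M.
apply: etrans (esym (mx2_1 R)).
by congr mx2; first [ring|ring: ww].
Qed.

Lemma expf2_1 w j k : (j <= k)%N -> w ^+ (2 ^ j) = 1 -> w ^+ (2 ^ k) = 1.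
Proof. by move=> /subnK <- h; rewrite expnD mulnC exprM h expr1n. Qed.

Lemma qubit_level_unitary k (M : 'M[C]_2) : qubit_level k M -> M \is unitarymx.
Proof.
move=> [c [w [p [hc hw hp ->]]]].
apply: scale_unitarymx (unity_conj _ hc) _; first by rewrite expn_gt0.
apply: mul_unitarymx; last exact: pauli_unitary.
by apply: diag_unitary (unity_conj _ hw); rewrite expn_gt0.
Qed.

Lemma qubit_level_conj k (M p : 'M[C]_2) : qubit_level k.+1 M ->
  p \in paulis R -> qubit_level k (M *m p *m M^t*).
Proof.
move=> [c [w [q [hc hw hq ->]]]] hp.
have cc : c * c^*%R = 1 by apply: unity_conj hc; rewrite expn_gt0.
have ww : w * w^*%R = 1 by apply: unity_conj hw; rewrite expn_gt0.
rewrite conj_scale_mx cc scale1r adjmxM mulmxA.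
have [s hs e] := pauli_conj hp hq.
have -> : mx2 1 0 0 w *m q *m p *m q^t* = s *: (mx2 1 0 0 w *m p).
  by rewrite -2!mulmxA [q *m _]mulmxA e scalemxAr.
have [t [w' [ht hw' e']]] := diag_conj_pauli ww hp.
rewrite -scalemxAl e' scalerA.
exists (s * t), w', p; split=> //; last first.
  by case: hw' => ->; rewrite ?expr1n // -exprM -expnS.
have -> : (s * t) ^+ (2 ^ k.+2) = t ^+ (2 ^ k.+2).
  rewrite exprMn expnS exprM; case: hs => ->; rewrite ?sqrrN !expr1n mul1r //.
by case: ht => ->; rewrite ?expr1n // -rmorphXn hw rmorph1.
Qed.

Lemma expr4_1 c : c ^+ 4 = 1 -> c \in [:: 1; - 1; 'i; - 'i].
Proof.
rewrite (exprM c 2 2) => /eqP; rewrite sqrf_eq1 => /orP[].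
  by rewrite sqrf_eq1 => /orP[]/eqP ->; rewrite !inE eqxx ?orbT.
rewrite -(sqrCi C) eqf_sqr => /orP[]/eqP ->;
  by rewrite !inE ?complexiE eqxx ?orbT.
Qed.

(** Conjugation acts qubit by qubit and cancels [c]; the phase of the conjugated Pauli operator is a
    fourth root of unity, so the induction keeps its form. *)
Lemma Cl_tensor (Q : finType) k c (u : Q -> 'M[C]_2) : c ^+ (2 ^ k.+2) = 1 ->
  (forall x, qubit_level k (u x)) -> Cl k (c *: tensor u).
Proof.
elim: k c u => [|k IH] c u hc hu.
  have [a] := fin_all_exists (fun x => qubit_level0 (hu x)).
  move=> /fin_all_exists[p hp].
  exists (c * \prod_x a x), p; split.
  - apply: expr4_1; rewrite exprMn hc mul1r -prodrXl big1 // => x _.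
    by have [] := hp x.
  - by move=> x; have [] := hp x.
  - rewrite -scalerA -tensorZ; congr (_ *: _); apply: eq_tensor => x.
    by have [] := hp x.
have cc : c * c^*%R = 1 by apply: unity_conj hc; rewrite expn_gt0.
split.
  apply: scale_unitarymx cc (tensor_unitary _) => x; exact: qubit_level_unitary.
move=> _ [c' [v [hc' hv ->]]].
rewrite conj_scale_mx cc scale1r -scalemxAr -scalemxAl tensor_adj !tensorM.
apply: IH => [|x]; last exact: qubit_level_conj.
apply: (@expf2_1 _ 2) => //.
have i4 : ('i : C) ^+ 4 = 1 by rewrite (exprM _ 2 2) sqrCi sqrrN expr1n.
move: hc'; rewrite !inE ?complexiE => /or4P[]/eqP ->;
  by rewrite ?(exprM _ 2 2) ?sqrrN -?exprM ?expr1n.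
Qed.

(** * The root of unity of the gates *)

Definition zroot k : C := expi (pi / 2 ^+ k).

Lemma expi_expr2 (t : R) k : expi t ^+ (2 ^ k) = expi (2 ^+ k * t).
Proof.
elim: k t => [|k IH] t; first by rewrite expr1 expr0 mul1r.
rewrite expnS exprM.
have -> : expi t ^+ 2 = expi (2 * t).
  rewrite expr2 /expi mulr_natl mulr2n cosD sinD.
  by apply/eqP; rewrite eq_complex /= [sin t * cos t]mulrC !eqxx.
by rewrite IH mulrA -exprSr.
Qed.

Lemma zroot_half k : zroot k ^+ (2 ^ k) = -1.
Proof.
rewrite /zroot expi_expr2 mulrC divfK ?expf_neq0 ?pnatr_eq0 //.
by rewrite /expi cospi sinpi; apply/eqP; rewrite eq_complex /= oppr0 !eqxx.
Qed.

(** The order is a power of two dividing [2 ^ k.+1]; a smaller one would turn the value -1 of the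
    [2 ^ k]-th power into 1. *)
Lemma zroot_prim k : (2 ^ k.+1).-primitive_root (zroot k).
Proof.
have z1 : zroot k ^+ (2 ^ k.+1) = 1.
  by rewrite expnS mulnC exprM zroot_half sqrrN expr1n.
have [n pn] := prim_order_exists (expn_gt0 2 k.+1) z1.
move=> /(dvdn_pfactor _ _ (isT : prime 2)) [j jk nj].
move: jk; rewrite leq_eqVlt => /orP[/eqP <-|jk]; first by rewrite -nj.
have : zroot k ^+ (2 ^ k) = 1.
  apply: (expf2_1 (j := j)) => //; rewrite -nj; exact: prim_expr_order.
by rewrite zroot_half => /eqP; rewrite eq_sym -addr_eq0 -mulr2n pnatr_eq0.
Qed.

Lemma zroot_neq0 k : zroot k != 0.
Proof.
have := zroot_half k; apply: contra_eq_neq => ->.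
by rewrite expr0n expn_eq0 /= eq_sym oppr_eq0 oner_eq0.
Qed.

Lemma zroot_exprz_eq1 k (z : int) :
  (exprz (zroot k) z == 1) = (2 ^+ k.+1 %| z)%Z.
Proof.
rewrite dvdzE abszX (prim_order_dvd (zroot_prim k)).
by case: z => n //; rewrite -[LHS]/((zroot k ^+ n.+1)^-1 == 1) invr_eq1.
Qed.

End Clifford.

(** * The code *)

Section Code.
Variables (R : realType) (m : nat).
Local Notation C := R[i].
Local Notation Q := (bitvec m).
Implicit Types (A B : {set Q}) (f g : qbasis Q) (psi : qstate R Q) (w : C).
Implicit Types (chi : Q -> int).

(** Integer exponents give alternating gates and adjoints the same form. *)
Definition phase_gate w chi A : qop R Q :=
  tensor (fun x => mx2 1 0 0 (if x \in A then exprz w (chi x) else 1)).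

Lemma exprz_sum w (I : Type) (s : seq I) (P : pred I) (F : I -> int) : w != 0 ->
  exprz w (\sum_(i <- s | P i) F i) = \prod_(i <- s | P i) exprz w (F i).
Proof.
by move=> w0; apply: (big_morph (exprz w)) => // a b; rewrite expfzDr.
Qed.

Lemma amp_phase_gate w chi A psi f : w != 0 ->
  amp (phase_gate w chi A *m psi) f = exprz w (phase chi A f) * amp psi f.
Proof.
move=> w0; pose v x (i : 'I_2) : C := if x \in A then exprz w (chi x * i%:Z) else 1.
rewrite (@amp_tensor _ _ _ 0 v) => [|x i j].
  by rewrite addr0 /phase exprz_sum // [in RHS]big_mkcond.
rewrite ffunE addr0 !mxE /v.
case: (I2_cases i) => ->; case: (I2_cases j) => -> //=; rewrite ?mulr0 ?mulr1 //.
by rewrite if_same.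
Qed.

Lemma phase_gate_adj w chi A : w * w^*%R = 1 ->
  (phase_gate w chi A)^t* = phase_gate w (fun x => - chi x) A.
Proof.
move=> ww; have w0 : w != 0.
  by apply: contra_eq_neq ww => ->; rewrite mul0r eq_sym oner_eq0.
have wV : w^*%R = w^-1 by apply: (mulfI w0); rewrite ww divff.
rewrite tensor_adj; apply: eq_tensor => x; rewrite mx2_adj rmorph0 rmorph1.
congr mx2; case: ifP => _; last by rewrite rmorph1.
by rewrite -exprz_inv -wV; exact: fmorphXz.
Qed.

Lemma phaseN chi A f : phase (fun x => - chi x) A f = - phase chi A f.
Proof. by rewrite /phase -sumrN; apply: eq_bigr => x _; rewrite mulNr. Qed.

Lemma amp_X B psi f : amp (on_qubits (pauliX R) B *m psi) f = amp psi (f + ind B).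
Proof.
rewrite (@amp_tensor _ _ _ (ind B) (fun _ _ => 1)) => [|x i j].
  by rewrite big1 // mul1r.
rewrite ffunE; case: ifP => _; rewrite !mxE;
by case: (I2_cases i) => ->; case: (I2_cases j) => ->.
Qed.

Lemma amp_Z B psi f : amp (on_qubits (pauliZ R) B *m psi) f =
  (-1) ^+ (\sum_(x in B) f x)%R * amp psi f.
Proof.
rewrite (@amp_tensor _ _ _ 0 (fun x i => if x \in B then (-1) ^+ i else 1)) => [|x i j].
  rewrite addr0 -big_mkcond /=; congr (_ * _).
  by rewrite signI2_sum.
rewrite ffunE addr0; case: ifP => _; rewrite !mxE;
by case: (I2_cases i) => ->; case: (I2_cases j) => ->.
Qed.

(** X-generators translate by cube indicators. Z-generators multiply amplitudes by signs, so a
    nonzero amplitude forces every parity sum to vanish. *)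
Lemma QRM_amp q r psi : QRM q r psi <->
  (forall B f, is_cube (m - q) B -> amp psi (f + ind B) = amp psi f) /\
  (forall f, amp psi f != 0 -> dual_cubes r.+1 f).
Proof.
split=> [[hX hZ]|[hX hZ]]; split.
- by move=> B f hB; rewrite -amp_X hX.
- move=> f f0 B hB; have := amp_Z B psi f; rewrite hZ //.
  case: (I2_cases (\sum_(x in B) f x)) => -> // /eqP.
  by rewrite expr1 mulN1r -addr_eq0 -mulr2n mulrn_eq0 (negbTE f0).
- by move=> B hB; apply: qstate_ext => f; rewrite amp_X hX.
- move=> B hB; apply: qstate_ext => f; rewrite amp_Z.
  have [->|f0] := eqVneq (amp psi f) 0; first by rewrite mulr0.
  by rewrite (hZ f f0 B hB) mul1r.
Qed.

(** The unnormalized uniform superposition over the coset of [f], used as a test state with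
    amplitude 1 at [f]; in characteristic two, sums are differences. *)
Definition coset_state n f : qstate R Q :=
  \col_s if `[< span_cubes n ((enum_val s : qbasis Q) + f) >] then 1 else 0.

Lemma amp_coset_state n f g :
  amp (coset_state n f) g = if `[< span_cubes n (g + f) >] then 1 else 0.
Proof. by rewrite /amp mxE enum_rankK. Qed.

Lemma addff f : f + f = 0.
Proof. by apply/ffunP => x; rewrite !ffunE addI2. Qed.

Lemma addfK g f : f + g + g = f.
Proof. by rewrite -addrA addff addr0. Qed.

Lemma span_cubes_add_ind n B f : is_cube n B ->
  span_cubes n (f + ind B) <-> span_cubes n f.
Proof.
move=> hB; have hI : span_cubes n (ind B) by apply: span_cubes_ind hB.
by split=> h; [rewrite -(addfK (ind B) f)|]; apply: span_cubesD.
Qed.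

Lemma coset_state_QRM q r f : (q < r)%N -> (r <= m)%N -> dual_cubes r.+1 f ->
  QRM q r (coset_state (m - q) f).
Proof.
move=> qr rm hf; apply/QRM_amp; split=> [B g hB|g].
  rewrite !amp_coset_state addrAC.
  by rewrite (asbool_equiv_eq (span_cubes_add_ind (g + f) hB)).
rewrite amp_coset_state; case: asboolP; last by rewrite eqxx.
move=> [s hs gf] _; rewrite -(addfK f g) gf addrC.
by apply: dual_cubes_span_ind hs hf; lia.
Qed.

Lemma amp_coset_state_self n f : amp (coset_state n f) f = 1.
Proof.
rewrite amp_coset_state addff; case: asboolP => // h.
by case: h; apply: span_cubes0.
Qed.

Lemma pauli_shift (p : 'M[C]_2) : p \in paulis R -> exists a : 'I_2, forall i,
  p i (i + a) != 0 /\ forall j, j != i + a -> p i j = 0.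
Proof.
case/paulisP => ->; [exists 0|exists 1|exists 1|exists 0] => i; split=> [|j];
  case: (I2_cases i) => ->; rewrite ?addr0 ?add0r ?addI2 ?mxE /=;
  rewrite ?oppr_eq0 ?oner_eq0 ?complexiE ?neq0Ci //;
  by case: (I2_cases j) => -> //; rewrite ?mxE.
Qed.

(** [g] is the X-part of [V]. *)
Lemma amp_pauli (V : qop R Q) : pauli_group V -> exists g (v : qbasis Q -> C),
  forall f, v f != 0 /\ forall psi, amp (V *m psi) f = v f * amp psi (f + g).
Proof.
move=> [c [u [hc hu ->]]].
have hp x := pauli_shift (hu x).
have [a ha] := fin_all_exists hp.
exists [ffun x => a x], (fun f => c * \prod_x u x (f x) (f x + a x)) => f; split.
  rewrite mulf_neq0 //.
    move: hc; rewrite !inE ?complexiE => /or4P[]/eqP ->;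
    by rewrite ?oppr_eq0 ?oner_eq0 ?neq0Ci.
  by apply/prodf_neq0 => x _; have [] := ha x (f x).
move=> psi; rewrite -scalemxAl /amp mxE -/(amp _ _) -mulrA; congr (_ * _).
apply: (@amp_tensor _ _ _ _ (fun x i => u x i (i + a x))) => x i j.
rewrite ffunE; case: eqP => [-> //|/eqP ne].
by have [_ ->] := ha x i.
Qed.

End Code.

(** * The gates acting on the code *)

Section Gate.
Variables (R : realType) (m : nat).
Local Notation C := R[i].
Local Notation Q := (bitvec m).
Implicit Types (A B : {set Q}) (f g : qbasis Q) (psi : qstate R Q).

Definition cube_gate k alt A : qop R Q :=
  phase_gate (zroot R k) (qubit_sign alt) A.

Lemma zroot_unity k : zroot R k ^+ (2 ^ k.+1) = 1.
Proof. exact: prim_expr_order (zroot_prim R k). Qed.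

Lemma zroot_conj k : zroot R k * (zroot R k)^*%R = 1.
Proof. by apply: unity_conj (zroot_unity k); rewrite expn_gt0. Qed.

Lemma exprz_qubit_sign (w : C) alt (x : Q) :
  exprz w (qubit_sign alt x) = if alt && odd (hweight x) then w^-1 else w.
Proof.
case: alt; rewrite /= ?expr1z // /wsign -signr_odd.
by case: (odd _); rewrite ?expr1 ?expr0 ?expr1z // exprN1.
Qed.

Lemma Z_on_gate k A : Z_on R k A = cube_gate k false A.
Proof.
by apply: eq_tensor => x; rewrite exprz_qubit_sign /=; case: ifP; rewrite ?mx2_1.
Qed.

Lemma Ztilde_on_gate k A : Ztilde_on R k A = cube_gate k true A.
Proof.
apply: eq_tensor => x; rewrite exprz_qubit_sign /=.
case: ifP => _; last by rewrite mx2_1.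
case: ifP => // _; rewrite mx2_adj rmorph0 rmorph1; congr mx2.
by apply: (mulfI (zroot_neq0 R k)); rewrite zroot_conj divff ?zroot_neq0.
Qed.

(** Levels above [k] are included because the normalizer condition at [k = 0] uses level 1. *)
Lemma Cl_cube_gate k j alt A : (k <= j)%N -> Cl j (cube_gate k alt A).
Proof.
move=> kj; rewrite -[cube_gate _ _ _]scale1r; apply: Cl_tensor => [|x].
  by rewrite expr1n.
exists 1, (if x \in A then exprz (zroot R k) (qubit_sign alt x) else 1), 1%:M.
split; rewrite ?expr1n ?mulmx1 ?scale1r ?inE ?eqxx //.
apply: (@expf2_1 _ _ k.+1) => //; rewrite exprz_qubit_sign.
case: ifP => _; last by rewrite expr1n.
by case: ifP => _; rewrite ?exprVn zroot_unity ?invr1.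
Qed.

(** The adjoint acts first and is read at [f + g], contributing the inverse phase there; the rest of
    [V] reproduces [psi]. *)
Lemma amp_conj_gate k alt A (V : qop R Q) g (v : qbasis Q -> C) psi f :
  (forall f psi, amp (V *m psi) f = v f * amp psi (f + g)) -> V *m psi = psi ->
  amp (cube_gate k alt A *m V *m (cube_gate k alt A)^t* *m psi) f =
  exprz (zroot R k) (phase (qubit_sign alt) A f - phase (qubit_sign alt) A (f + g))
    * amp psi f.
Proof.
move=> hV Vpsi; rewrite -!mulmxA amp_phase_gate ?zroot_neq0 // hV.
rewrite phase_gate_adj ?zroot_conj // amp_phase_gate ?zroot_neq0 // phaseN.
rewrite expfzDr ?zroot_neq0 // -mulrA; congr (_ * _).
by rewrite mulrCA -hV Vpsi.
Qed.

Section RM.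
Variables (q r : nat).
Hypotheses (qr : (q < r)%N) (rm : (r <= m)%N).

(** The coset state of [f] detects the phase at [f]; conversely, code states are supported on RM(r,
    m). *)
Lemma Sk_cube_gate k alt A : Sk (QRM (R := R) q r) k (cube_gate k alt A) <->
  (forall f, dual_cubes r.+1 f -> (2 ^+ k.+1 %| phase (qubit_sign alt) A f)%Z).
Proof.
split=> [[_ h] f hf|h].
  rewrite -(zroot_exprz_eq1 R).
  have := amp_phase_gate (qubit_sign alt) A (coset_state R (m - q) f) f
    (zroot_neq0 R k).
  by rewrite h ?amp_coset_state_self ?mulr1 => [<- //|]; apply: coset_state_QRM.
split; first exact: Cl_cube_gate.
move=> psi /QRM_amp[_ hpsi]; apply: qstate_ext => f.
rewrite amp_phase_gate ?zroot_neq0 //.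
have [->|f0] := eqVneq (amp psi f) 0; first by rewrite mulr0.
have /eqP -> : exprz (zroot R k) (phase (qubit_sign alt) A f) == 1.
  by rewrite zroot_exprz_eq1 h //; apply: hpsi.
by rewrite mul1r.
Qed.

Lemma X_cube_stabilizer B : is_cube (m - q) B ->
  Sk (QRM (R := R) q r) 0 (on_qubits (pauliX R) B).
Proof.
move=> hB; split; last by move=> psi [hX _]; apply: hX.
exists 1, (fun x => if x \in B then pauliX R else 1%:M); split.
- by rewrite inE eqxx.
- by move=> x; case: ifP => _; rewrite !inE eqxx ?orbT.
- by rewrite scale1r.
Qed.

(** Necessity is tested on the X-generators. For sufficiency, the X-part of any stabilizer is a sum
    of cubes, and the phase differences telescope. *)
Lemma Nk_cube_gate k alt A : Nk (QRM (R := R) q r) k (cube_gate k alt A) <->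
  (forall f B, dual_cubes r.+1 f -> is_cube (m - q) B ->
    (2 ^+ k.+1 %| phase (qubit_sign alt) A (f + ind B) -
                  phase (qubit_sign alt) A f)%Z).
Proof.
split=> [[_ h] f B hf hB|h].
  have hV := X_cube_stabilizer hB; have [_ fixU] := h _ hV.
  have psiC := coset_state_QRM R qr rm hf.
  have := amp_conj_gate k alt A f (g := ind B) (v := fun _ => 1)
    (fun f psi => etrans (amp_X B psi f) (esym (mul1r _))) (hV.2 _ psiC).
  rewrite fixU // amp_coset_state_self mulr1 => /esym/eqP.
  by rewrite zroot_exprz_eq1 -opprB rpredN.
split; first exact: Cl_cube_gate.
move=> V [hV fixV]; have [g [v hv]] := amp_pauli hV.
have hVg f psi : amp (V *m psi) f = v f * amp psi (f + g) by have [_ ->] := hv f.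
(* [V] fixes the coset state of 0, whose amplitude at [g] is therefore the nonzero factor [v g]; so
   [g] lies in its support. *)
have gspan : span_cubes (m - q) g.
  have := hVg g (coset_state R (m - q) 0).
  rewrite fixV; last exact: coset_state_QRM (@dual_cubes0 _ _).
  rewrite addff amp_coset_state_self mulr1 amp_coset_state addr0.
  by case: asboolP => // _ v0; have [/eqP[]] := hv g.
split.
  (* For [k = 0] this is level 1, so the conjugate is again a Pauli operator. *)
  have : Cl (k.-1).+1 (cube_gate k alt A) by apply: Cl_cube_gate; case: (k).
  by move=> /= [_]; apply.
move=> psi hpsi; apply: qstate_ext => f.
rewrite (amp_conj_gate _ _ _ _ hVg) ?fixV //.
have [->|f0] := eqVneq (amp psi f) 0; first by rewrite mulr0.
have [_ /(_ f f0) hf] := (QRM_amp q r psi).1 hpsi.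
suff /eqP -> : exprz (zroot R k) (phase (qubit_sign alt) A f -
    phase (qubit_sign alt) A (f + g)) == 1 by rewrite mul1r.
rewrite zroot_exprz_eq1 -opprB rpredN.
by apply: (phase_span_dvd (n := m - q) (r := r.+1)) => //; lia.
Qed.

End RM.
End Gate.

Theorem theorem6p2 (R : realType) (m q r k : nat) (hqr : (q < r)%N)
    (hrm : (r <= m)%N) (d : nat) (A : {set bitvec m}) (hA : is_cube d A) :
  [/\ Sk (QRM (R := R) q r) k (Ztilde_on R k A) <-> ((k + 1) * r + 1 <= d)%N,
      Ek (QRM (R := R) q r) k (Ztilde_on R k A) <->
        (q + k * r + 1 <= d <= (k + 1) * r)%N,
      Sk (QRM (R := R) q r) k (Z_on R k A) <-> ((k + 1) * r + 1 <= d)%N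
    & Ek (QRM (R := R) q r) k (Z_on R k A) <->
        (q + k * r + 1 <= d <= (k + 1) * r)%N].
Proof.
have r0 : (0 < r)%N by lia.
have qm : (q <= m)%N by lia.
rewrite Ztilde_on_gate Z_on_gate; case: hA => [x [J [<- ->]]].
have hS alt : Sk (QRM (R := R) q r) k (cube_gate R k alt (subcube x J)) <->
    ((k + 1) * r + 1 <= #|J|)%N.
  exact: iff_trans (Sk_cube_gate R hqr hrm k alt _) (phase_dvdP alt k x J r0 hrm).
have hE alt : Ek (QRM (R := R) q r) k (cube_gate R k alt (subcube x J)) <->
    (q + k * r + 1 <= #|J| <= (k + 1) * r)%N.
  (* The normalizer condition is the step criterion at [e = q]; failure of the stabilizer condition
     gives the upper bound on the dimension. *)
  have hN := iff_trans (Nk_cube_gate R hqr hrm k alt (subcube x J))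
    (phase_step_dvdP alt k x J r0 hrm qm).
  rewrite /Ek hN hS addn1 [X in ~ (X <= _)%N]addn1 (rwP negP) -leqNgt.
  by split=> /andP.
by split.
Qed.
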